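(* For every field $\mathbb{F}$ and all $m>n$, every tree-like $\mathrm{Res}_{sw}(\mathrm{lin}_{\mathbb{F}})$ refutation of $\neg\mathrm{PHP}^m_n$ has size $2^{\Omega(\frac{n-1}{2})}$.
   Context: $\neg\mathrm{PHP}^m_n$ is the CNF over variables $x_{i,j}$ ($i\in[m]$, $j\in[n]$) consisting of the clauses $\bigvee_{j\in[n]}x_{i,j}$ for each $i\in[m]$ and $\neg x_{i,j}\vee\neg x_{i',j}$ for all $i\ne i'\in[m]$, $j\in[n]$; a CNF is viewed as a set of linear clauses by writing a literal $x$ as $x=1$ and $\neg x$ as $x=0$. A linear clause over $\mathbb{F}$ is a disjunction of linear equations $f=0$, $f=\sum_i a_ix_i+b$ (duplicates identified); variables range over $\{0,1\}$ and $\models$ denotes semantic implication with respect to 0-1 assignments. The system $\mathrm{Res}_{sw}(\mathrm{lin}_{\mathbb{F}})$ has the single axiom $0=0$ and the rules: resolution (from $C\vee f=0$ and $D\vee g=0$ derive $C\vee D\vee(\alpha f+\beta g=0)$, $\alpha,\beta\in\mathbb{F}$) and semantic weakening (from $C$ derive any linear clause $D$ with $C\models D$). A refutation of a set $\phi$ of linear clauses is a sequence of linear clauses ending in the empty clause, each in $\phi$, the axiom, or obtained from earlier ones by a rule; tree-like means every occurrence of a clause is used at most once as a premise. Size is the total number of variable occurrences plus the total size of coefficients. *)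

(* Defs.v *)
From HB Require Import structures.
From mathcomp Require Import all_boot all_order all_algebra finmap.
From mathcomp Require Import reals exp.

Set Implicit Arguments.
Unset Strict Implicit.
Unset Printing Implicit Defensive.

Import GRing.Theory.

Local Open Scope ring_scope.

Section ResLin.

Variables (F : fieldType) (V : finType).

(* [(a, b)] stands for the affine form [\sum_v a v * x_v + b], and, as a member
   of a linear clause, for the equation [\sum_v a v * x_v + b = 0]. Equations
   are compared formally: [f = 0] and [a f = 0] are different disjuncts. *)
Definition affine : Type := ({ffun V -> F} * F)%type.
HB.instance Definition _ := Choice.on affine.

Definition aff0 : affine := ([ffun=> 0], 0).

Definition aff_comb (a : F) (f : affine) (b : F) (g : affine) : affine :=
  ([ffun v => a * f.1 v + b * g.1 v], a * f.2 + b * g.2).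

Definition aff_eval (x : {ffun V -> bool}) (f : affine) : F :=
  \sum_(v : V) f.1 v * (x v)%:R + f.2.

Definition lin_clause : Type := {fset affine}.

Definition sat (x : {ffun V -> bool}) (C : lin_clause) : Prop :=
  exists2 f, f \in C & aff_eval x f = 0.

Definition entails (C D : lin_clause) : Prop := forall x, sat x C -> sat x D.

Definition resolvent (P Q E : lin_clause) : Prop :=
  exists (C D : lin_clause) (f g : affine) (a b : F),
    [/\ P = (f |` C)%fset, Q = (g |` D)%fset
      & E = (aff_comb a f b g |` (C `|` D))%fset].

(* How a line is obtained; premises are given by the positions of lines. *)
Inductive rule : Type :=
  | Clause_of_formula
  | Zero_axiom
  | Resolution of nat & nat
  | Weakening of nat.

Definition premises (r : rule) : seq nat :=
  match r with
  | Resolution i j => [:: i; j]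
  | Weakening i => [:: i]
  | _ => [::]
  end.

Definition derivation : Type := seq (lin_clause * rule).

Definition clause_at (pi : derivation) (k : nat) : lin_clause :=
  nth fset0 (map fst pi) k.

Definition rule_at (pi : derivation) (k : nat) : rule :=
  nth Zero_axiom (map snd pi) k.

Definition correct_line (phi : seq lin_clause) (pi : derivation) (k : nat) :
    Prop :=
  let C := clause_at pi k in
  match rule_at pi k with
  | Clause_of_formula => C \in phi
  | Zero_axiom => C = [fset aff0]%fset
  | Resolution i j =>
      [/\ (i < k)%N, (j < k)%N & resolvent (clause_at pi i) (clause_at pi j) C]
  | Weakening i => (i < k)%N /\ entails (clause_at pi i) C
  end.

Definition refutation (phi : seq lin_clause) (pi : derivation) : Prop :=
  [/\ (0 < size pi)%N,
      forall k, (k < size pi)%N -> correct_line phi pi k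
    & clause_at pi (size pi).-1 = fset0].

(* Repetitions count: a line may not be both premises of one resolution. *)
Definition tree_like (pi : derivation) : Prop :=
  uniq (flatten [seq premises l.2 | l <- pi]).

Section Size.

(* [csize a] is the size of (an encoding of) the field element [a]. *)
Variable csize : F -> nat.

Definition aff_size (f : affine) : nat :=
  (\sum_(v : V | f.1 v != 0%R) (1 + csize (f.1 v))
   + (if f.2 != 0%R then csize f.2 else 0))%N.

Definition clause_size (C : lin_clause) : nat :=
  (\sum_(f <- C) aff_size f)%N.

Definition derivation_size (pi : derivation) : nat :=
  (\sum_(l <- pi) clause_size l.1)%N.

End Size.

(* [(v, true)] is the literal [x_v], and [(v, false)] its negation. *)
Definition literal : Type := (V * bool)%type.
Definition cnf : Type := seq (seq literal).

(* The equation [x_v = 1], resp. [x_v = 0], as an affine form set to zero. *)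
Definition aff_of_literal (l : literal) : affine :=
  ([ffun v => (v == l.1)%:R], - (l.2)%:R).

Definition lin_of_cnf (phi : cnf) : seq lin_clause :=
  [seq [fset aff_of_literal l | l in c]%fset | c <- phi].

End ResLin.

Definition pigeon_clause (m n : nat) (i : 'I_m) :
    seq (literal ('I_m * 'I_n)%type) :=
  [seq ((i, j), true) | j <- enum 'I_n].

Definition hole_clause (m n : nat) (i i' : 'I_m) (j : 'I_n) :
    seq (literal ('I_m * 'I_n)%type) :=
  [:: ((i, j), false); ((i', j), false)].

Definition neg_php (m n : nat) : cnf ('I_m * 'I_n)%type :=
  [seq pigeon_clause n i | i <- enum 'I_m] ++
  [seq hole_clause p.1.1 p.1.2 p.2
     | p <- enum {: 'I_m * 'I_m * 'I_n} & p.1.1 != p.1.2].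

(* Main.v *)
Require Import Defs.
From mathcomp Require Import all_boot all_order all_algebra finmap.
From mathcomp Require Import reals exp.
From mathcomp Require Import zify ring.

(** Delayer's side of a prover-delayer game, played from the empty clause up to
   the leaves. Delayer keeps a list [fs] of affine forms such that every proper
   assignment (no hole receives two pigeons) on which all of [fs] are nonzero
   falsifies the current clause. At a resolution on [f] and [g] either one
   premise inherits the property, or both do after adding [f], resp. [g], to
   [fs]; only the second case lengthens [fs], and it doubles the number of
   leaves. A leaf that is a pigeon clause can only be reached when
   [n <= 2 * size fs]: a product of [k] affine forms has degree at most [k], so
   it cannot be nonzero at exactly one vertex of a cube of dimension [> k].
   Applied to the ones of a minimal proper assignment this leaves at most [k]
   holes occupied; applied to the free holes of pigeon [i] it puts [i] in one
   of them. *)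

Set Implicit Arguments.
Unset Strict Implicit.
Unset Printing Implicit Defensive.

Import Order.TTheory GRing.Theory Num.Theory.

Local Open Scope ring_scope.

(** * Affine forms on Boolean cubes *)

Section AffineForms.

Variables (F : fieldType) (V : finType).
Implicit Types (x y : {ffun V -> bool}) (S T : {set V}).
Implicit Types (f g : affine F V) (fs : seq (affine F V)).

Lemma sum_sign_subsets (T : {set V}) :
  T != set0 -> \sum_(S : {set V} | S \subset T) (-1) ^+ #|S| = 0 :> F.
Proof.
case/set0Pn=> v vT.
(* Expanding the product selects a subset [S]; the entries [0] kill every [S] not inside [T], and
   the factor at [v] is [-1 + 1]. *)
transitivity (\prod_(i : V) ((if i \in T then -1 else 0) + 1 : F)); last first.
  by rewrite (bigD1 v) //= vT addNr mul0r.
rewrite bigA_distr big_mkcond; apply: eq_bigr => S _.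
case: ifPn => [/subsetP sST | /subsetPn[i iS iT]]; last first.
  by rewrite (bigD1 i) //= iS (negPf iT) mul0r.
rewrite -prodr_const big_mkcond; apply: eq_bigr => i _.
by case: ifP => // /sST ->.
Qed.

(** An alternating sum over a cube kills polynomials of degree below its dimension. When the first
    form is expanded, its constant part vanishes by induction; the part of [v] keeps only the [S]
    containing [v], whose sum is the one over [T] minus the one over [T :\ v], both zero by
    induction. *)
Lemma sum_sign_prod_affine fs T :
  (size fs < #|T|)%N ->
  \sum_(S : {set V} | S \subset T)
     (-1) ^+ #|S| * \prod_(f <- fs) (f.2 + \sum_(v in S) f.1 v) = 0.
Proof.
elim: fs T => [|f fs IH] T /= ltT.
  rewrite -[RHS](@sum_sign_subsets T) -?card_gt0 //.
  by apply: eq_bigr => S _; rewrite big_nil mulr1.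
pose w S : F := (-1) ^+ #|S| * \prod_(h <- fs) (h.2 + \sum_(v in S) h.1 v).
transitivity (\sum_(S : {set V} | S \subset T) f.2 * w S +
    \sum_(S : {set V} | S \subset T)
      \sum_(v in T) (if v \in S then f.1 v * w S else 0)).
  rewrite -big_split /=; apply: eq_bigr => S sST.
  rewrite big_cons mulrCA mulrDl; congr (_ + _).
  rewrite mulr_suml big_mkcond [RHS]big_mkcond; apply: eq_bigr => v _.
  by case: ifP => vS; [rewrite (subsetP sST _ vS) | case: ifP].
rewrite -mulr_sumr IH ?(ltnW ltT) // mulr0 add0r exchange_big big1 //= => v vT.
have sumT : \sum_(S : {set V} | S \subset T) w S = 0 by rewrite IH // ltnW.
have sumTv : \sum_(S : {set V} | S \subset T :\ v) w S = 0.
  by rewrite IH // -ltnS; move: ltT; rewrite (cardsD1 v T) vT.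
rewrite -big_mkcondr /= -mulr_sumr; apply/eqP; rewrite mulf_eq0.
apply/orP; right.
move/eqP: sumT; rewrite (bigID (fun S : {set V} => v \in S)) /=.
rewrite [X in _ + X](eq_bigl (fun S : {set V} => S \subset T :\ v)).
  by rewrite sumTv addr0.
by move=> S; rewrite subsetD1.
Qed.

Definition avoids fs x : bool := all (fun f => aff_eval x f != 0) fs.

Definition flip x S : {ffun V -> bool} := [ffun v => x v (+) (v \in S)].

(** Flipping [x v] changes it by [1 - 2 * x v = (-1) ^+ x v], so [f] is again affine in coordinates
    centred at [x]. *)
Lemma aff_eval_flip x S f :
  aff_eval (flip x S) f = aff_eval x f + \sum_(v in S) (-1) ^+ x v * f.1 v.
Proof.
rewrite /aff_eval addrAC; congr (_ + _).
rewrite [X in _ = _ + X]big_mkcond -big_split /=; apply: eq_bigr => v _.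
by rewrite ffunE; case: (x v); case: (v \in S) => /=; ring.
Qed.

(** Otherwise the product of the forms is nonzero only at [S = set0], and the alternating sum
    reduces to that one nonzero term. *)
Lemma avoids_flip fs x T :
  (size fs < #|T|)%N -> avoids fs x ->
  exists S, [/\ S \subset T, S != set0 & avoids fs (flip x S)].
Proof.
move=> ltT av.
case: (pickP [pred S : {set V} |
    [&& S \subset T, S != set0 & avoids fs (flip x S)]]) => [S /and3P[]|no].
  by exists S.
pose h f : affine F V := ([ffun v => (-1) ^+ x v * f.1 v], aff_eval x f).
have hE S : \prod_(f <- map h fs) (f.2 + \sum_(v in S) f.1 v)
          = \prod_(f <- fs) aff_eval (flip x S) f.
  rewrite big_map; apply: eq_bigr => f _; rewrite aff_eval_flip /=.
  by congr (_ + _); apply: eq_bigr => v _; rewrite ffunE.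
have := @sum_sign_prod_affine (map h fs) T; rewrite size_map => /(_ ltT).
rewrite (bigD1 set0) ?sub0set //= [X in _ + X]big1 => [|S /andP[sST nS]].
  rewrite addr0 cards0 expr0 mul1r hE => /eqP.
  rewrite prodf_seq_eq0 => /hasP[f ffs /= /eqP f0].
  move: (allP av f ffs); rewrite -f0 aff_eval_flip big_set0 addr0.
  by rewrite eqxx.
have := no S; rewrite /= sST nS /= => /negbT /allPn[f ffs /negPn f0].
apply/eqP; rewrite mulf_eq0 hE prodf_seq_eq0; apply/orP; right.
by apply/hasP; exists f.
Qed.

(** Flips within the ones of [x] only erase ones; as long as more than [size fs] remain, some flip
    lowers their number. *)
Lemma avoids_few_ones fs x :
  avoids fs x ->
  exists y, [/\ forall v, y v -> x v, (#|[set v | y v]| <= size fs)%N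
              & avoids fs y].
Proof.
have [N] := ubnP #|[set v | x v]|.
elim: N x => // N IH x ltN av.
have [le|lt] := leqP #|[set v | x v]| (size fs); first by exists x.
have [S [/subsetP sS /set0Pn[v vS] avS]] := avoids_flip lt av.
have sub u : flip x S u -> x u.
  rewrite ffunE; case: (boolP (u \in S)) => [/sS|]; first by rewrite inE => ->.
  by rewrite addbF.
have [|y [yx cy ay]] := IH (flip x S) _ avS.
  rewrite -ltnS (leq_trans _ ltN) // ltnS; apply: proper_card.
  apply/properP; split; first by apply/subsetP => u; rewrite !inE; apply: sub.
  by exists v; [apply: sS | have := sS v vS; rewrite !inE !ffunE vS => ->].
by exists y; split=> // u /yx /sub.
Qed.

Lemma aff_eval_comb x a f b g :
  aff_eval x (aff_comb a f b g) = a * aff_eval x f + b * aff_eval x g.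
Proof.
rewrite /aff_eval /= !mulrDr addrACA; congr (_ + _).
by rewrite !mulr_sumr -big_split; apply: eq_bigr => v _; rewrite ffunE /=; ring.
Qed.

Lemma aff_eval_literal x (l : literal V) :
  aff_eval x (aff_of_literal F l) = (x l.1)%:R - (l.2)%:R.
Proof.
rewrite /aff_eval /= (bigD1 l.1) //= ffunE eqxx mul1r big1 ?addr0 // => v.
by move=> /negPf nv; rewrite ffunE nv mul0r.
Qed.

Lemma sat_literal x (c : seq (literal V)) l :
  l \in c -> x l.1 = l.2 -> sat x [fset aff_of_literal F l | l in c]%fset.
Proof.
move=> lc xl; exists (aff_of_literal F l); first by apply/imfsetP; exists l.
by rewrite aff_eval_literal xl subrr.
Qed.

(** A variable occurrence counts 1 apart from its coefficient, so this holds for every [csize]. *)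
Lemma clause_size_literals_gt0 (csize : F -> nat) (c : seq (literal V)) :
  c != [::] ->
  (0 < clause_size csize [fset aff_of_literal F l | l in c]%fset)%N.
Proof.
case: c => // l c _; rewrite /clause_size.
rewrite (big_rem (aff_of_literal F l)) /=; last first.
  by apply/imfsetP; exists l => //; rewrite mem_head.
rewrite /aff_size (bigD1 l.1) ?ffunE ?eqxx ?oner_eq0 //=.
Qed.

End AffineForms.

(** * Leaves of tree-like derivations and Delayer's strategy *)

Section TreeLike.

Variables (F : fieldType) (V : finType).
Implicit Types (pi : derivation F V) (phi : seq (lin_clause F V)).
Implicit Types (fs : seq (affine F V)) (C : lin_clause F V).

(** Paths grow at the end away from [k], so inversion exposes the line that uses [l]. *)
Inductive descendant pi (k : nat) : nat -> Prop :=
  | Descendant_refl : descendant pi k k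
  | Descendant_step i l :
      descendant pi k i -> l \in premises (rule_at pi i) -> descendant pi k l.

Lemma descendant_premise pi k i l :
  i \in premises (rule_at pi k) -> descendant pi i l -> descendant pi k l.
Proof.
move=> ik; elim=> [|j {}l _ kj jl]; last exact: Descendant_step kj jl.
exact: Descendant_step (Descendant_refl _ _) ik.
Qed.

Lemma rule_at_default pi k : (size pi <= k)%N -> rule_at pi k = Zero_axiom.
Proof. by move=> le; rewrite /rule_at nth_default ?size_map. Qed.

Lemma premises_lt phi pi k i :
  (forall j, (j < size pi)%N -> correct_line phi pi j) ->
  i \in premises (rule_at pi k) -> (i < k)%N.
Proof.
move=> ok; have [le|lt] := leqP (size pi) k; first by rewrite rule_at_default.
move: (ok k lt); rewrite /correct_line; case: (rule_at pi k) => //= [a b|a].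
  by case=> ak bk _; rewrite !inE => /orP[] /eqP ->.
by case=> ak _; rewrite inE => /eqP ->.
Qed.

Lemma descendant_leq phi pi k l :
  (forall j, (j < size pi)%N -> correct_line phi pi j) ->
  descendant pi k l -> (l <= k)%N.
Proof.
move=> ok; elim=> // i {}l _ le /(premises_lt ok) lt.
exact: leq_trans (ltnW lt) le.
Qed.

Lemma uniq_flatten_nth (T : eqType) (ss : seq (seq T)) i j x :
  uniq (flatten ss) -> x \in nth [::] ss i -> x \in nth [::] ss j -> i = j.
Proof.
elim: ss i j => [|s ss IH] i j; first by rewrite nth_nil.
have disj k :
    uniq (flatten (s :: ss)) -> x \in s -> x \in nth [::] ss k -> False.
  rewrite /= cat_uniq => /and3P[_ /hasPn no _] xs xk.
  have [lt|le] := ltnP k (size ss); last by rewrite nth_default in xk.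
  have /no/negP[] // : x \in flatten ss.
  by apply/flattenP; exists (nth [::] ss k); rewrite ?mem_nth.
case: i j => [|i] [|j] u //= xi xj.
- by case: (disj _ u xi xj).
- by case: (disj _ u xj xi).
- by congr _.+1; apply: IH xi xj; move: u; rewrite /= cat_uniq => /and3P[].
Qed.

Lemma premises_nth pi k :
  premises (rule_at pi k) = nth [::] [seq premises l.2 | l <- pi] k.
Proof.
rewrite /rule_at; have [lt|le] := ltnP k (size pi); last first.
  by rewrite !nth_default ?size_map.
by rewrite !(nth_map (fset0, Zero_axiom)).
Qed.

Lemma tree_like_parent pi i j l : tree_like pi ->
  l \in premises (rule_at pi i) -> l \in premises (rule_at pi j) -> i = j.
Proof. by rewrite !premises_nth => u; apply: uniq_flatten_nth u. Qed.

Lemma tree_like_resolution pi k i j :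
  tree_like pi -> rule_at pi k = Resolution i j -> i != j.
Proof.
move=> u rk; have [lt|le] := ltnP k (size pi); last first.
  by rewrite rule_at_default in rk.
apply/eqP => ij; move: u; rewrite /tree_like.
rewrite -(cat_take_drop k [seq premises l.2 | l <- pi]) flatten_cat.
rewrite cat_uniq => /and3P[_ _]; rewrite (drop_nth [::]) ?size_map //.
by rewrite -premises_nth rk /= ij mem_head.
Qed.

(** Each line has at most one parent, so the paths up from [l] to [i] and to [j] coincide until one
    of them ends. *)
Lemma descendant_comparable pi i j l : tree_like pi ->
  descendant pi i l -> descendant pi j l ->
  descendant pi i j \/ descendant pi j i.
Proof.
move=> u; elim=> [|a {}l ia IH al jl]; first by right.
case: jl al IH ia => [|b {}l jb bl] al IH ia.
  by left; apply: Descendant_step ia al.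
by apply: IH; rewrite (tree_like_parent u al bl).
Qed.

Lemma resolution_descendants_disjoint phi pi k i j l :
  (forall j, (j < size pi)%N -> correct_line phi pi j) -> tree_like pi ->
  rule_at pi k = Resolution i j ->
  descendant pi i l -> descendant pi j l -> False.
Proof.
move=> ok u rk il jl; have neq := tree_like_resolution u rk.
have [ik jk] : i \in premises (rule_at pi k) /\ j \in premises (rule_at pi k).
  by rewrite rk !inE !eqxx orbT.
(* A descendant of a sibling would have the common parent [k] as a proper
   descendant of that sibling. *)
have no a b : a != b -> a \in premises (rule_at pi k) ->
    b \in premises (rule_at pi k) -> descendant pi a b -> False.
  move=> ab ak bk dab; case: dab ab bk => [|c {}b ac bc] ab bk.
    by rewrite eqxx in ab.
  have ck := tree_like_parent u bc bk; move: ac; rewrite ck.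
  by move=> /(descendant_leq ok); rewrite leqNgt (premises_lt ok ak).
case: (descendant_comparable u il jl); first exact: no neq ik jk.
by apply: no; rewrite // eq_sym.
Qed.

(** Only leaves taken from the formula count, since the axiom [0 = 0] has size 0. *)
Definition leaves_below pi (k N : nat) : Prop :=
  exists s : seq nat, [/\ uniq s, (N <= size s)%N &
    forall l, l \in s -> descendant pi k l /\ rule_at pi l = Clause_of_formula].

Lemma leaves_below_premise pi k i N :
  i \in premises (rule_at pi k) -> leaves_below pi i N -> leaves_below pi k N.
Proof.
move=> ik [s [us Ns sl]]; exists s; split=> // l /sl[il rl].
by split=> //; apply: descendant_premise ik il.
Qed.

Lemma leaves_below_resolution phi pi k i j M N :
  (forall j, (j < size pi)%N -> correct_line phi pi j) -> tree_like pi ->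
  rule_at pi k = Resolution i j ->
  leaves_below pi i M -> leaves_below pi j N -> leaves_below pi k (M + N).
Proof.
move=> ok u rk [s [us Ms sl]] [t [ut Nt tl]]; exists (s ++ t); split.
- rewrite cat_uniq us ut andbT /=; apply/hasPn => l /tl[jl _].
  apply/negP => /sl[il _].
  exact: resolution_descendants_disjoint ok u rk il jl.
- by rewrite size_cat leq_add.
- move=> l; rewrite mem_cat => /orP[/sl[dl rl] | /tl[dl rl]]; split=> //.
    by apply: descendant_premise dl; rewrite rk mem_head.
  by apply: descendant_premise dl; rewrite rk !inE eqxx orbT.
Qed.

(* The subtraction truncates: for [t = 0] there is no bound on [size fs]. *)
Lemma delayer phi pi (good : pred {ffun V -> bool}) (d : nat) :
  (forall fs x C, (size fs < d)%N -> good x -> avoids fs x -> C \in phi ->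
     exists y, [/\ good y, avoids fs y & sat y C]) ->
  (forall k, (k < size pi)%N -> correct_line phi pi k) -> tree_like pi ->
  forall k fs t, (k < size pi)%N -> (t <= d - size fs)%N ->
  (exists2 x, good x & avoids fs x) ->
  (forall x, good x -> avoids fs x -> ~ sat x (clause_at pi k)) ->
  leaves_below pi k (2 ^ t).
Proof.
move=> phiP ok u k; have [N] := ubnP k; elim: N k => // N IH k kN fs t kpi led.
move=> [x gx ax] unsat; move: (ok k kpi); rewrite /correct_line.
case rk: (rule_at pi k) => [||i j|i].
(* For [t = 0] the leaf itself is enough; for [t > 0] there is room [size fs < d], and [phiP]
   contradicts [unsat]. *)
- move=> Cphi; case: t led => [|t] led.
    exists [:: k]; split=> // l; rewrite inE => /eqP ->.
    by split=> //; apply: Descendant_refl.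
  have [|y [gy ay sy]] := phiP fs x _ _ gx ax Cphi.
    by rewrite -subn_gt0; apply: leq_trans led.
  by case: (unsat y gy ay).
- move=> Ck; case: (unsat x gx ax); exists (aff0 F V).
    by rewrite Ck inE.
  rewrite /aff_eval /= addr0 big1 // => v _; by rewrite ffunE mul0r.
- case=> ik jk [C [D [f [g [a [b [Pi Pj Ek]]]]]]].
  have res y : good y -> avoids fs y ->
      [/\ aff_eval y f != 0 -> ~ sat y (clause_at pi i),
          aff_eval y g != 0 -> ~ sat y (clause_at pi j)
        & (aff_eval y f != 0) || (aff_eval y g != 0)].
    move=> gy ay; have ns := unsat y gy ay; rewrite Ek in ns.
    split.
    + move/eqP=> nf; rewrite Pi => -[h]; rewrite !inE => /orP[/eqP -> //|hC h0].
      by apply: ns; exists h; rewrite // !inE hC orbT.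
    + move/eqP=> ng; rewrite Pj => -[h]; rewrite !inE => /orP[/eqP -> //|hD h0].
      by apply: ns; exists h; rewrite // !inE hD !orbT.
    + rewrite -negb_and; apply/negP => /andP[/eqP f0 /eqP g0].
      apply: ns; exists (aff_comb a f b g); first by rewrite !inE eqxx.
      by rewrite aff_eval_comb f0 g0 !mulr0 addr0.
  have ikp : i \in premises (rule_at pi k) by rewrite rk mem_head.
  have jkp : j \in premises (rule_at pi k) by rewrite rk !inE eqxx orbT.
  have iN : (i < N)%N by apply: leq_trans ik _; rewrite -ltnS.
  have jN : (j < N)%N by apply: leq_trans jk _; rewrite -ltnS.
  have ipi := ltn_trans ik kpi; have jpi := ltn_trans jk kpi.
  (* If [f] has no zero among the good assignments avoiding [fs], premise [i] is falsified with [fs]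
     unchanged; likewise for [g] and [j]. *)
  case: (pickP [pred y | [&& good y, avoids fs y & aff_eval y f == 0]])
      => [y /and3P[gy ay f0] | nof]; last first.
    apply: (leaves_below_premise ikp); apply: (IH i iN fs) => //.
      by exists x.
    move=> y gy ay; have [nf _ _] := res y gy ay; apply: nf.
    by have := nof y; rewrite /= gy ay /= => ->.
  case: (pickP [pred y | [&& good y, avoids fs y & aff_eval y g == 0]])
      => [z /and3P[gz az g0] | nog]; last first.
    apply: (leaves_below_premise jkp); apply: (IH j jN fs) => //.
      by exists x.
    move=> z gz az; have [_ ng _] := res z gz az; apply: ng.
    by have := nog z; rewrite /= gz az /= => ->.
  (* The witnesses cross over: the zero [y] of [f] avoids [g :: fs], and the zero [z] of [g] avoids
     [f :: fs]. *)
  have g1 : aff_eval y g != 0 by have [_ _] := res y gy ay; rewrite f0.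
  have f1 : aff_eval z f != 0 by have [_ _] := res z gz az; rewrite g0 orbF.
  have leafi t' : (t' <= d - (size fs).+1)%N -> leaves_below pi i (2 ^ t').
    move=> le; apply: (IH i iN (f :: fs)) => //.
    + by exists z => //=; rewrite f1.
    + by move=> w gw /= /andP[fw aw]; have [nf _ _] := res w gw aw; apply: nf.
  have leafj t' : (t' <= d - (size fs).+1)%N -> leaves_below pi j (2 ^ t').
    move=> le; apply: (IH j jN (g :: fs)) => //.
    + by exists y => //=; rewrite g1.
    + by move=> w gw /= /andP[fw aw]; have [_ nf _] := res w gw aw; apply: nf.
  case: t led => [|t] led.
    by apply: leaves_below_premise ikp _; apply: leafi.
  have led' : (t <= d - (size fs).+1)%N.
    by rewrite subnS -ltnS (leq_trans led) ?leqSpred.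
  rewrite expnS mul2n -addnn.
  exact: leaves_below_resolution ok u rk (leafi t led') (leafj t led').
- case=> ik ent; apply: (@leaves_below_premise _ _ i); first by rewrite rk inE.
  apply: (IH i _ fs) => //; first by apply: leq_trans ik _; rewrite -ltnS.
  + exact: ltn_trans ik kpi.
  + by exists x.
  + by move=> y gy ay /ent; apply: unsat.
Qed.

End TreeLike.

(** * The pigeonhole formula and the size bound *)

Section Pigeons.

Variables (F : fieldType) (m n : nat).
Implicit Types (x y z : {ffun 'I_m * 'I_n -> bool}).
Implicit Types (fs : seq (affine F ('I_m * 'I_n)%type)).

(** A pigeon may sit in several holes or in none: these are exactly the assignments satisfying all
    hole clauses. *)
Definition proper_holes x : bool :=
  [forall i : 'I_m, forall i' : 'I_m, forall j : 'I_n,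
     x (i, j) && x (i', j) ==> (i == i')].

Lemma proper_holesP x :
  reflect (forall i i' j, x (i, j) -> x (i', j) -> i = i') (proper_holes x).
Proof.
apply: (iffP forallP) => [h i i' j xi xi' | h i].
  by move: (h i) => /forallP/(_ i')/forallP/(_ j); rewrite xi xi' => /eqP.
apply/forallP => i'; apply/forallP => j; apply/implyP => /andP[xi xi'].
by apply/eqP; apply: h xi xi'.
Qed.

Lemma place_pigeon fs x (i : 'I_m) :
  (size fs < uphalf n)%N -> proper_holes x -> avoids fs x ->
  exists z j, [/\ proper_holes z, avoids fs z & z (i, j)].
Proof.
move=> lt /proper_holesP px /avoids_few_ones[y [yx cy ay]].
have py : forall a b j, y (a, j) -> y (b, j) -> a = b.
  by move=> a b j ya yb; apply: px (yx _ ya) (yx _ yb).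
case: (pickP (fun j => y (i, j))) => [j yij | noi].
  by exists y, j; split=> //; apply/proper_holesP.
pose used := [set v.2 | v in [set v | y v]].
(* Flips confined to pigeon [i] and to holes empty under [y] cannot put two pigeons in one hole. *)
pose T := [set (i, j) | j in ~: used].
have ltT : (size fs < #|T|)%N.
  rewrite card_imset => [|j j' []//].
  have := cardsC used; rewrite card_ord.
  have : (#|used| <= #|[set v | y v]|)%N by apply: leq_imset_card.
  (* With [k = size fs], [k < uphalf n] gives [2 * k < n]; at most [k] holes are used, so more than
     [k] are free. *)
  lia.
have [S [/subsetP sS /set0Pn[[i0 j] vS] aS]] := avoids_flip ltT ay.
have inS a k : (a, k) \in S -> a = i /\ k \notin used.
  by move=> /sS /imsetP[k' k'u [-> ->]]; move: k'u; rewrite inE.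
have free a k : (a, k) \in S -> forall b, y (b, k) = false.
  move=> /inS[_ nu] b; apply: contraNF nu => ybk.
  by apply/imsetP; exists (b, k); rewrite ?inE.
exists (flip y S), j; split=> //; last first.
  by have [i0E _] := inS _ _ vS; subst i0; rewrite ffunE noi vS.
apply/proper_holesP => a b k; rewrite !ffunE.
case: (boolP ((a, k) \in S)) => aS'; case: (boolP ((b, k) \in S)) => bS'.
- by have [-> _] := inS _ _ aS'; have [-> _] := inS _ _ bS'.
- by rewrite (free _ _ aS' b).
- by rewrite (free _ _ bS' a).
- by rewrite !addbF; apply: py.
Qed.

(** A hole clause already holds at [x]; only a pigeon clause forces a move to another assignment. *)
Lemma neg_php_satisfiable_avoiding fs x C :
  (size fs < uphalf n)%N -> proper_holes x -> avoids fs x ->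
  C \in lin_of_cnf F (neg_php m n) ->
  exists y, [/\ proper_holes y, avoids fs y & sat y C].
Proof.
move=> lt px ax /mapP[c]; rewrite mem_cat => /orP[/mapP[i _ ->] ->|].
  have [z [j [pz az zij]]] := place_pigeon i lt px ax.
  exists z; split=> //; apply: (@sat_literal _ _ _ _ ((i, j), true)) => //.
  by apply/mapP; exists j; rewrite ?mem_enum.
case/mapP=> [[[i i'] j]]; rewrite mem_filter /= => /andP[neq _] -> ->.
exists x; split=> //; case xij: (x (i, j)).
  apply: (@sat_literal _ _ _ _ ((i', j), false)).
    by rewrite !inE eqxx orbT.
  apply/negP => /= xi'j; case/eqP: neq.
  by move/proper_holesP: px; apply; [exact: xij | exact: xi'j].
by apply: (@sat_literal _ _ _ _ ((i, j), false)); rewrite ?mem_head.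
Qed.

Lemma neg_php_clause_size (csize : F -> nat) C :
  (0 < n)%N -> C \in lin_of_cnf F (neg_php m n) -> (0 < clause_size csize C)%N.
Proof.
move=> n0 /mapP[c cphi ->]; apply: clause_size_literals_gt0.
move: cphi; rewrite mem_cat => /orP[/mapP[i _ ->] | /mapP[p _ ->] //].
by rewrite -size_eq0 size_map -cardE card_ord -lt0n.
Qed.

(** Started at the empty clause with no forms and the all-false assignment, the game yields
    [2 ^ uphalf n] distinct leaf positions, each of size at least 1. *)
Lemma neg_php_tree_like_size (csize : F -> nat)
    (pi : derivation F ('I_m * 'I_n)%type) :
  (0 < n)%N -> refutation (lin_of_cnf F (neg_php m n)) pi -> tree_like pi ->
  (2 ^ uphalf n <= derivation_size csize pi)%N.
Proof.
move=> n0 [pi0 ok last0] u.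
have [||||s [us ges sl]] := delayer neg_php_satisfiable_avoiding ok u
    (k := (size pi).-1) (fs := [::]) (t := uphalf n) _ _ _.
- by rewrite prednK.
- by rewrite subn0.
- by exists [ffun=> false] => //; apply/proper_holesP => i i' j; rewrite ffunE.
- by move=> x _ _ [f]; rewrite last0 inE.
apply: leq_trans ges _.
have slt l : l \in s -> (l < size pi)%N.
  by case/sl=> _ rl; rewrite ltnNge; apply/negP => /rule_at_default; rewrite rl.
(* Summing over positions counts equal clauses on different lines separately. *)
have -> : derivation_size csize pi
    = (\sum_(0 <= k < size pi) clause_size csize (clause_at pi k))%N.
  rewrite /derivation_size (big_nth (fset0, Zero_axiom)).
  apply: eq_big_nat => k /andP[_ kpi].
  by rewrite /clause_at (nth_map (fset0, Zero_axiom)).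
rewrite -sum1_size.
apply: (@leq_trans (\sum_(k <- s) clause_size csize (clause_at pi k))%N).
  rewrite !big_seq; apply: leq_sum => l ls; apply: neg_php_clause_size => //.
  by have := ok l (slt l ls); rewrite /correct_line; case: (sl l ls) => _ ->.
apply: (uniq_sub_le_big leqnn (fun a b => leq_addr b a)) => //.
  exact: iota_uniq.
by move=> l /slt; rewrite mem_index_iota.
Qed.

End Pigeons.

Theorem mainTheorem5 (R : realType) :
  exists2 c : R, 0 < c &
    forall (F : fieldType) (csize : F -> nat) (m n : nat)
           (pi : derivation F ('I_m * 'I_n)%type),
      (0 < n)%N -> (n < m)%N ->
      refutation (lin_of_cnf F (neg_php m n)) pi -> tree_like pi ->
      2 `^ (c * ((n%:R - 1) / 2)) <= (derivation_size csize pi)%:R.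
Proof.
(* The constant 1 works because [(n - 1) / 2 <= uphalf n]. *)
exists 1 => // F csize m n pi n0 _ ref u; rewrite mul1r.
have := neg_php_tree_like_size csize n0 ref u; rewrite -(ler_nat R).
apply: le_trans; rewrite natrX -powR_mulrn //.
apply: ler_powR; first by rewrite ler1n.
rewrite ler_pdivrMr // -natrM lerBlDr natr1 ler_nat.
lia.
Qed.
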